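(* Let $n\ge 1$ and let $[X,Y]$ be a partially Stone space, partially ordered with the open set partial order, such that: (1) $Y$ is poset isomorphic to $2^n$; (2) the elements of $X\setminus Y$ are pairwise incomparable; (3) every $y\in Y$ has a unique cover $x\in X\setminus Y$; (4) every $x\in X\setminus Y$ covers exactly one $y\in Y$. Then $[X,Y]$ and the partially Stone space corresponding to the partially complemented distributive lattice $\mathcal X(\mathbf S^n,\mathbf S)$ are homeomorphic as partially Stone spaces, i.e. there is a homeomorphism between the underlying spaces carrying $Y$ onto the distinguished subset of the other space.
   Context: A partially Stone space $[X,Y]$ is a spectral (coherent, sober) space $X$ together with a distinguished compact open subset $Y\subseteq X$ such that the subspace $X\setminus Y$ is a Stone space. The open set partial order on a $T_0$-space $X$ is: $x\le y$ iff every open subset containing $y$ also contains $x$. A partially complemented distributive lattice is a bounded distributive lattice $L$ with a constant $h$ such that the interval $[h,1]$ is a Boolean algebra. For finite $L$, the partially Stone space corresponding to $L$ has as points the prime filters of $L$, identified with the set $L_J$ of join-irreducible elements ($x\leftrightarrow{\uparrow}x$); its open sets are the sets $\phi(I)=\{p\mid p\cap I\ne\emptyset\}$ for $I$ an ideal of $L$; its distinguished subset is $\{x\in L_J\mid x\le h\}$. $S=\{0,h,1\}$ is the chain $0<h<1$; $r_1=S^2\setminus\{(1,0)\}$, $r_2=S^2\setminus\{(h,0),(1,0)\}$, $r_3=S^2\setminus\{(0,1),(h,1),(1,0),(1,h)\}$; $\mathbf S=\langle S;\{r_1,r_2,r_3\},\mathcal T\rangle$ with $\mathcal T$ discrete.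 $\mathcal X(\mathbf S^n,\mathbf S)$ is the set of maps $f:S^n\to S$ preserving $r_1,r_2,r_3$ (for each $k$: if $(x_i,y_i)\in r_k$ for all $i$, then $(f(x),f(y))\in r_k$), a partially complemented distributive lattice under the pointwise operations, with $0,h,1$ the constant maps. $2^n$ is the $n$-th power of the two-element chain. *)

(* Defs.v *)
From HB Require Import structures.
From mathcomp Require Import all_boot all_order.
From mathcomp Require Import boolp classical_sets functions filter.
From mathcomp Require Import topology.

Set Implicit Arguments.
Unset Strict Implicit.
Unset Printing Implicit Defensive.

Import Order.TTheory.

Local Open Scope classical_set_scope.

Definition irreducible_set (X : topologicalType) (A : set X) : Prop :=
  A !=set0 /\
  forall B C : set X, closed B -> closed C ->
    A `<=` B `|` C -> A `<=` B \/ A `<=` C.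

Definition sober (X : topologicalType) : Prop :=
  forall A : set X, closed A -> irreducible_set A ->
    exists! x : X, closure [set x] = A.

(* The compact open sets form a base closed under finite intersections, the
   empty intersection being the whole space. *)
Definition coherent (X : topologicalType) : Prop :=
  [/\ compact [set: X],
      forall U V : set X, open U -> compact U -> open V -> compact V ->
        compact (U `&` V)
    & forall (U : set X) (x : X), open U -> U x ->
        exists V : set X, [/\ open V, compact V, V x & V `<=` U]].

Definition spectral (X : topologicalType) : Prop := coherent X /\ sober X.

Definition stone_space (X : topologicalType) : Prop :=
  [/\ compact [set: X], hausdorff_space X & totally_disconnected [set: X]].

(* The library's topology on [set_type A] is the one induced by the ambient
   space. *)
Definition partially_stone (X : topologicalType) (Y : set X) : Prop :=
  [/\ spectral X, open Y, compact Y & stone_space (set_type (~` Y))].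

Definition homeomorphism (X Z : topologicalType) (f : X -> Z) : Prop :=
  continuous f /\
  exists g : Z -> X, [/\ cancel f g, cancel g f & continuous g].

Definition partially_stone_homeomorphic (X : topologicalType) (Y : set X)
    (X' : topologicalType) (Y' : set X') : Prop :=
  exists f : X -> X', homeomorphism f /\ f @` Y = Y'.

Definition open_le (X : topologicalType) (x y : X) : Prop :=
  forall U : set X, open U -> U y -> U x.

Definition covers (X : topologicalType) (x y : X) : Prop :=
  [/\ open_le y x, y <> x
    & forall z : X, open_le y z -> open_le z x -> z = y \/ z = x].

(* [n.-tupleprod bool] carries the componentwise order. *)
Definition iso_bool_power (n : nat) (X : topologicalType) (Y : set X) : Prop :=
  exists2 f : X -> n.-tupleprod bool, set_bij Y [set: n.-tupleprod bool] f
    & forall x y : X, Y x -> Y y -> (f x <= f y)%O <-> open_le x y.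

Section PrimeFilters.
Context (d : Order.disp_t) (L : tbDistrLatticeType d).
Implicit Types I J : set L.

Record prime_filter := PrimeFilter {
  pf_set :> set L;
  pf_top : pf_set \top%O;
  pf_up : forall a b : L, (a <= b)%O -> pf_set a -> pf_set b;
  pf_meet : forall a b : L, pf_set a -> pf_set b -> pf_set (a `&` b)%O;
  pf_bot : ~ pf_set \bot%O;
  pf_prime : forall a b : L, pf_set (a `|` b)%O -> pf_set a \/ pf_set b
}.

Definition lattice_ideal I : Prop :=
  [/\ I \bot%O,
      forall a b : L, (a <= b)%O -> I b -> I a
    & forall a b : L, I a -> I b -> I (a `|` b)%O].

Definition phi I : set prime_filter := [set p | p `&` I !=set0].

Definition pf_open : set_system prime_filter :=
  [set U | exists2 I, lattice_ideal I & U = phi I].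

Fact pf_openT : pf_open setT.
Proof.
exists setT; first by [].
by apply/seteqP; split=> // p _; exists \top%O; split=> //; apply: pf_top.
Qed.

Fact pf_openI : setI_closed pf_open.
Proof.
move=> _ _ [I [I0 Id Iu] ->] [J [J0 Jd Ju] ->].
exists (I `&` J).
  split=> [|a b ab [/(Id _ _ ab) ? /(Jd _ _ ab) ?]|a b [? ?] [? ?]] //.
  by split; [apply: Iu | apply: Ju].
apply/seteqP; split=> p.
  move=> [[a [pa Ia]] [b [pb Jb]]]; exists (a `&` b)%O.
  by split; [apply: pf_meet | split; [apply: Id Ia | apply: Jd Jb];
    rewrite ?leIl ?leIr].
by move=> [a [pa [Ia Ja]]]; split; exists a.
Qed.

Fact pf_open_bigU (T : Type) (f : T -> set prime_filter) :
  (forall i, pf_open (f i)) -> pf_open (\bigcup_i f i).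
Proof.
move=> fo.
pose K := [set a : L | forall J, lattice_ideal J ->
  (forall i I, lattice_ideal I -> f i = phi I -> I `<=` J) -> J a].
exists K.
  split=> [J [J0 _ _] _ //|a b ab Kb J iJ HJ|a b Ka Kb J iJ HJ].
    by case: (iJ) => _ Jd _; apply: Jd ab _; apply: Kb.
  by case: (iJ) => _ _ Ju; apply: Ju; [apply: Ka | apply: Kb].
apply/seteqP; split=> p.
  move=> [i _]; have [I iI fE] := fo i; rewrite fE => -[a [pa Ia]].
  by exists a; split=> // J iJ HJ; exact: (HJ i I iI fE a Ia).
move=> [a [pa Ka]]; apply: contrapT => np.
suff: (~` p) a by [].
apply: Ka.
  split=> [|b c bc npc pb|b c nb nc /pf_prime []] //; first exact: pf_bot.
  exact: npc (pf_up bc pb).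
move=> i I iI fE b Ib pb; apply: np; exists i => //.
by rewrite fE; exists b.
Qed.

HB.instance Definition _ := gen_eqMixin prime_filter.
HB.instance Definition _ := gen_choiceMixin prime_filter.
HB.instance Definition _ :=
  isOpenTopological.Build prime_filter pf_openT pf_openI pf_open_bigU.

Definition join_irreducible (x : L) : Prop :=
  x <> \bot%O /\ forall a b : L, x = (a `|` b)%O -> x = a \/ x = b.

End PrimeFilters.

Arguments prime_filter {d} L.

Record finPCDL (d : Order.disp_t) := FinPCDL {
  pcdl_lattice :> finTBDistrLatticeType d;
  pcdl_h : pcdl_lattice;
  pcdl_complement : forall a : pcdl_lattice, (pcdl_h <= a)%O ->
    exists b : pcdl_lattice,
      [/\ (pcdl_h <= b)%O, (a `&` b)%O = pcdl_h & (a `|` b)%O = \top%O]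
}.

Arguments pcdl_h {d} L : rename.

Definition dual_space (d : Order.disp_t) (L : finPCDL d) : topologicalType :=
  prime_filter L.

(* The set of x in L_J with x <= h, where x stands for the prime filter of the
   elements above x. *)
Definition dual_distinguished (d : Order.disp_t) (L : finPCDL d) :
    set (dual_space L) :=
  [set p : prime_filter L | exists x : L,
    [/\ join_irreducible x, (x <= pcdl_h L)%O
      & pf_set p = [set y : L | (x <= y)%O]]].

(* The chain 0 < h < 1, as 'I_3 with its usual order. *)
Notation S3 := 'I_3.
Definition s0 : S3 := @Ordinal 3 0 isT.
Definition sh : S3 := @Ordinal 3 1 isT.
Definition s1 : S3 := @Ordinal 3 2 isT.

Definition r1 : rel S3 := fun a b => (a, b) \notin [:: (s1, s0)].
Definition r2 : rel S3 := fun a b => (a, b) \notin [:: (sh, s0); (s1, s0)].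
Definition r3 : rel S3 := fun a b =>
  (a, b) \notin [:: (s0, s1); (sh, s1); (s1, s0); (s1, sh)].

Definition preserves (n : nat) (r : rel S3) (f : {ffun n.-tuple S3 -> S3}) :
    bool :=
  [forall x : n.-tuple S3, forall y : n.-tuple S3,
    [forall i : 'I_n, r (tnth x i) (tnth y i)] ==> r (f x) (f y)].

Definition is_hom (n : nat) : pred {ffun n.-tuple S3 -> S3} :=
  fun f => [&& preserves r1 f, preserves r2 f & preserves r3 f].

Definition homs (n : nat) : Type := {f : {ffun n.-tuple S3 -> S3} | is_hom f}.

Section HomLattice.
Variable n : nat.
Implicit Types (r : rel S3) (f g k : {ffun n.-tuple S3 -> S3}) (u v w : homs n).

HB.instance Definition _ := Finite.on (homs n).

Definition ffun_meet f g := [ffun x => (f x `&` g x)%O].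
Definition ffun_join f g := [ffun x => (f x `|` g x)%O].

Local Lemma preservesP r f :
  reflect (forall x y : n.-tuple S3,
             (forall i, r (tnth x i) (tnth y i)) -> r (f x) (f y))
          (preserves r f).
Proof.
apply: (iffP forallP) => [H x y xy|H x].
  by have /forallP/(_ y)/implyP := H x; apply; apply/forallP.
by apply/forallP => y; apply/implyP => /forallP /H.
Qed.

Local Lemma S3_cases (a : S3) : [\/ a = s0, a = sh | a = s1].
Proof.
case: a => -[|[|[|//]]] i; [constructor 1|constructor 2|constructor 3];
  exact/val_inj.
Qed.

Local Lemma homI f g : is_hom f -> is_hom g -> is_hom (ffun_meet f g).
Proof.
move=> /and3P[/preservesP f1 /preservesP f2 /preservesP f3].
move=> /and3P[/preservesP g1 /preservesP g2 /preservesP g3].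
apply/and3P; split; apply/preservesP => x y xy; rewrite !ffunE;
  [move: (f1 _ _ xy) (g1 _ _ xy)|move: (f2 _ _ xy) (g2 _ _ xy)
  |move: (f3 _ _ xy) (g3 _ _ xy)];
  by case: (S3_cases (f x)) => ->; case: (S3_cases (f y)) => ->;
     case: (S3_cases (g x)) => ->; case: (S3_cases (g y)) => ->.
Qed.

Local Lemma homU f g : is_hom f -> is_hom g -> is_hom (ffun_join f g).
Proof.
move=> /and3P[/preservesP f1 /preservesP f2 /preservesP f3].
move=> /and3P[/preservesP g1 /preservesP g2 /preservesP g3].
apply/and3P; split; apply/preservesP => x y xy; rewrite !ffunE;
  [move: (f1 _ _ xy) (g1 _ _ xy)|move: (f2 _ _ xy) (g2 _ _ xy)
  |move: (f3 _ _ xy) (g3 _ _ xy)];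
  by case: (S3_cases (f x)) => ->; case: (S3_cases (f y)) => ->;
     case: (S3_cases (g x)) => ->; case: (S3_cases (g y)) => ->.
Qed.

Local Lemma hom_cst (c : S3) : is_hom [ffun _ : n.-tuple S3 => c].
Proof.
by apply/and3P; split; apply/preservesP => x y _; rewrite !ffunE;
  case: (S3_cases c) => ->.
Qed.

Definition hom_le u v := [forall x, (val u x <= val v x)%O].
Definition hom_lt u v := (v != u) && hom_le u v.
Definition hom_meet u v : homs n := exist (@is_hom n) _ (homI (valP u) (valP v)).
Definition hom_join u v : homs n := exist (@is_hom n) _ (homU (valP u) (valP v)).
Definition hom_const (c : S3) : homs n := exist (@is_hom n) _ (hom_cst c).

Local Lemma hom_ext u v : (forall x, val u x = val v x) -> u = v.
Proof. by move=> uv; apply/val_inj/ffunP. Qed.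

Fact hom_display : Order.disp_t. Proof. exact: (Order.Disp tt tt). Qed.

Fact hom_le_def u v : hom_le u v = (hom_meet u v == u).
Proof.
apply/forallP/eqP => [le_uv|uv x].
  by apply: hom_ext => x; rewrite ffunE; apply/meet_idPl.
by rewrite -uv /= ffunE leIr.
Qed.

Fact hom_meetC : commutative hom_meet.
Proof. by move=> u v; apply: hom_ext => x; rewrite !ffunE meetC. Qed.
Fact hom_joinC : commutative hom_join.
Proof. by move=> u v; apply: hom_ext => x; rewrite !ffunE joinC. Qed.
Fact hom_meetA : associative hom_meet.
Proof. by move=> u v w; apply: hom_ext => x; rewrite !ffunE meetA. Qed.
Fact hom_joinA : associative hom_join.
Proof. by move=> u v w; apply: hom_ext => x; rewrite !ffunE joinA. Qed.
Fact hom_joinKI v u : hom_meet u (hom_join u v) = u.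
Proof. by apply: hom_ext => x; rewrite !ffunE joinKI. Qed.
Fact hom_meetKU v u : hom_join u (hom_meet u v) = u.
Proof. by apply: hom_ext => x; rewrite !ffunE meetKU. Qed.
Fact hom_meetUl : left_distributive hom_meet hom_join.
Proof. by move=> u v w; apply: hom_ext => x; rewrite !ffunE meetUl. Qed.
Fact hom_meetxx : idempotent_op hom_meet.
Proof. by move=> u; apply: hom_ext => x; rewrite !ffunE meetxx. Qed.

HB.instance Definition _ := Order.isMeetJoinDistrLattice.Build hom_display
  (homs n) hom_le_def (fun _ _ => erefl) hom_meetC hom_joinC hom_meetA hom_joinA
  hom_joinKI hom_meetKU hom_meetUl hom_meetxx.

Fact hom_le0x u : (hom_const s0 <= u)%O.
Proof. by apply/forallP => x; rewrite ffunE; apply: le0x. Qed.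
Fact hom_lex1 u : (u <= hom_const s1)%O.
Proof.
by apply/forallP => x; rewrite ffunE; case: (S3_cases (val u x)) => ->.
Qed.

HB.instance Definition _ :=
  Order.hasBottom.Build hom_display (homs n) hom_le0x.
HB.instance Definition _ := Order.hasTop.Build hom_display (homs n) hom_lex1.

Fact hom_complement u : (hom_const sh <= u)%O ->
  exists v, [/\ (hom_const sh <= v)%O, (u `&` v)%O = hom_const sh
              & (u `|` v)%O = \top%O].
Proof.
move=> /forallP hu.
have {}hu x : val u x = sh \/ val u x = s1.
  by have := hu x; rewrite ffunE; case: (S3_cases (val u x)) => ->; auto.
pose c f := [ffun x => if f x == s1 then sh else s1] : {ffun n.-tuple S3 -> S3}.
have homc : is_hom (c (val u)).
  have /and3P[_ _ /preservesP u3] := valP u.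
  apply/and3P; split; apply/preservesP => x y xy; rewrite !ffunE;
    try by case: (hu x) => ->; case: (hu y) => ->.
  by have := u3 x y xy; case: (hu x) => ->; case: (hu y) => ->.
exists (exist (@is_hom n) _ homc); split; [apply/forallP => x|apply: hom_ext => x..];
  rewrite !ffunE; case: (hu x) => -> //; exact/val_inj.
Qed.

End HomLattice.

Definition hom_pcdl (n : nat) : finPCDL hom_display :=
  @FinPCDL hom_display (homs n) (hom_const n sh) (@hom_complement n).

(* Main.v *)
(* A map f preserves r1, r2 and r3 exactly when {f >= h} depends monotonically
   on the set of coordinates that are at least h, {f = 1} depends only on the
   set of coordinates equal to 1, and f(x) = 1 forces f(y) >= h as soon as y is
   at least h wherever x is 1.  The prime filters of the lattice of these maps
   are therefore indexed by two copies of the cube 2^n: the points of the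
   distinguished copy carry the order of the cube, and those of the other copy
   form an antichain, each of them lying above exactly the cone below one point
   of the distinguished copy.  The hypotheses force the same order on X, which
   is finite and T0, so that its topology is determined by its order. *)
Require Import Defs.
From mathcomp Require Import all_boot all_order.
From mathcomp Require Import boolp classical_sets functions filter.
From mathcomp Require Import topology.

Set Implicit Arguments.
Unset Strict Implicit.
Unset Printing Implicit Defensive.

Import Order.TTheory.

Local Open Scope classical_set_scope.

(** * The open set order, and finite spaces determined by it *)

Section OpenOrder.
Context (X : topologicalType).
Implicit Types x y z : X.

Lemma open_le_refl x : open_le x x.
Proof. by []. Qed.

Lemma open_le_trans y x z : open_le x y -> open_le y z -> open_le x z.
Proof. by move=> xy yz U oU /(yz _ oU)/(xy _ oU). Qed.

Lemma closure_set1E x : closure [set x] = [set z | open_le x z].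
Proof.
apply/seteqP; split=> z.
  move=> cz U oU Uz.
  by have [_ [->]] := cz _ (open_nbhs_nbhs (conj oU Uz)).
move=> xz B; rewrite nbhsE => -[U [oU Uz] UB].
by exists x; split; [|apply/UB/(xz U)].
Qed.

(** Both points have the same irreducible closure, and sobriety makes its generic point unique. *)
Lemma sober_open_le_anti x y :
  sober X -> open_le x y -> open_le y x -> x = y.
Proof.
move=> sX xy yx.
have cyE : closure [set y] = closure [set x].
  rewrite !closure_set1E; apply/seteqP.
  by split=> z; apply: open_le_trans.
have irr : irreducible_set (closure [set x]).
  split; first by exists x; apply: subset_closure.
  move=> B C cB cC BC.
  by have [Bx|Cx] := BC _ (subset_closure (erefl x)); [left|right];
    rewrite closureE; apply: smallest_sub => // _ ->.
have [z [_ uz]] := sX _ (@closed_closure _ _) irr.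
by rewrite -(uz x) // -(uz y).
Qed.

Section Finite.
Context (T : finType) (e : X -> T).
Hypothesis e_inj : injective e.

(** Each point not below [y] misses some open neighbourhood of [y]. As [e] makes the space finite,
    one such neighbourhood per code [k] can be intersected. *)
Lemma finite_open_le_nbhs y : \forall z \near y, open_le z y.
Proof.
have : \forall z \near y, forall (k : T) w, e w = k -> z = w -> open_le w y.
  apply: filter_forall => k.
  have [[w [ewk nwy]]|nw] := pselect (exists w, e w = k /\ ~ open_le w y).
    have [U [oU Uy nUw]] : exists U, [/\ open U, U y & ~ U w].
      apply: contrapT => nU; apply: nwy => U oU Uy.
      by apply: contrapT => nUw; apply: nU; exists U.
    apply: filterS (open_nbhs_nbhs (conj oU Uy)) => z Uz w' ew'k zw'.
    by case: nUw; rewrite (e_inj (etrans ewk (esym ew'k))) -zw'.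
  by apply: nearW => z w ewk _; apply: contrapT => nwy; apply: nw; exists w.
by apply: filterS => z /(_ (e z) z erefl erefl).
Qed.

Lemma finite_open_le_continuous (Z : topologicalType) (f : X -> Z) :
  (forall x y, open_le x y -> open_le (f x) (f y)) -> continuous f.
Proof.
move=> fle; apply/continuousP => A oA; rewrite openE => x Ax.
apply: filterS (finite_open_le_nbhs x) => z zx.
by apply: (fle _ _ zx).
Qed.

Hypothesis open_le_anti : forall x y, open_le x y -> open_le y x -> x = y.

(** Induction on the difference in size of the down-sets of [x] and [y]: a point strictly between
    replaces [y] and shrinks it. *)
Lemma finite_covers_exists x y : open_le y x -> y <> x ->
  exists2 z, open_le y z & covers x z.
Proof.
pose below z := [set k : T | `[< exists2 w, e w = k & open_le w z >]]%SET.
have below_lt z w : open_le z w -> z <> w -> (below z \proper below w)%SET.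
  move=> zw zNw; apply/properP; split.
    apply/fintype.subsetP => k; rewrite !inE => -[v evk vz].
    by exists v => //; apply: open_le_trans zw.
  exists (e w); rewrite !inE; first by exists w.
  by apply/asboolP => -[v /e_inj -> wz]; apply/zNw/open_le_anti.
have [m] := ubnP (#|below x| - #|below y|).
elim: m y => // m IH y; rewrite ltnS => lem yx yNx.
have [[w [yw wx wNy wNx]]|nw] := pselect
    (exists w, [/\ open_le y w, open_le w x, w <> y & w <> x]).
  have [|z wz xz] := IH w _ wx wNx; last first.
    by exists z => //; apply: open_le_trans wz.
  apply: leq_trans lem.
  have := proper_card (below_lt _ _ yw (nesym wNy)).
  have := proper_card (below_lt _ _ wx wNx).
  by move=> wx_lt yw_lt; apply: ltn_sub2l => //; apply: ltn_trans wx_lt.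
exists y => //; split=> // z yz zx.
have [->|zNy] := eqVneq z y; first by left.
by right; apply: contrapT => zNx; apply: nw; exists z; split=> //; apply/eqP.
Qed.

End Finite.

End OpenOrder.

(** Both spaces are finite, so monotone maps between them are continuous in either direction. *)
Lemma homeomorphism_of_codes (X Z : topologicalType) (T : finType)
    (r : rel T) (e : X -> T) (G : T -> Z) :
  bijective e -> bijective G ->
  (forall x y, open_le x y <-> r (e x) (e y)) ->
  (forall s t, open_le (G s) (G t) <-> r s t) ->
  homeomorphism (G \o e).
Proof.
move=> [e' eK e'K] [G' GK G'K] er Gr; split.
  apply: (finite_open_le_continuous (can_inj eK)) => x y xy /=.
  by apply/Gr/er.
exists (e' \o G'); split=> [x|z|] /=; rewrite ?GK ?eK ?e'K ?G'K //.
apply: (finite_open_le_continuous (can_inj G'K)) => x y xy /=.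
by apply/er; rewrite !e'K; apply/Gr; rewrite !G'K.
Qed.

(** * Prime filters of a finite distributive lattice *)

Section PrimeFilterSpace.
Context (d : Order.disp_t) (L : finTBDistrLatticeType d).
Implicit Types p q : prime_filter L.

Lemma prime_filter_inj p q : pf_set p = pf_set q -> p = q.
Proof.
case: p q => [A A1 A2 A3 A4 A5] [B B1 B2 B3 B4 B5] /= AB.
by case: B / AB B1 B2 B3 B4 B5 => *; congr PrimeFilter; apply: Prop_irrelevance.
Qed.

Lemma prime_filter_open_le p q : open_le p q <-> pf_set q `<=` pf_set p.
Proof.
split=> [pq a qa|qp _ [I iI ->] [a [qa Ia]]]; last first.
  by exists a; split=> //; apply: qp.
(* The principal ideal of [a] gives an open set around [q]; since [p] meets this ideal, it contains
   [a]. *)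
have oU : open (phi [set b : L | (b <= a)%O]).
  exists [set b : L | (b <= a)%O] => //.
  split=> [|b c /= bc ca|b c /= ba ca]; first exact: le0x.
    exact: le_trans bc ca.
  by rewrite leUx ba.
have [|b [pb /= ba]] := pq _ oU; first by exists a; split => /=.
exact: pf_up ba pb.
Qed.

Lemma prime_filter_principal p : exists m : L, pf_set p = [set u | (m <= u)%O].
Proof.
exists (\meet_(u | `[< pf_set p u >]) u)%O; apply/seteqP; split=> u /=.
  by move=> pu; apply: meets_inf; apply/asboolP.
move=> mu; apply: pf_up mu _.
elim/big_ind: _ => [|a b|a /asboolP] //; [exact: pf_top|exact: pf_meet].
Qed.

Lemma prime_filter_big_join p (I : finType) (P : pred I) (F : I -> L) :
  pf_set p (\join_(i | P i) F i)%O -> exists2 i, P i & pf_set p (F i).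
Proof.
elim/big_rec: _ => [/pf_bot //|i a Pi IH /pf_prime[|//]].
by exists i.
Qed.

Lemma prime_filter_join_irreducible p (m : L) :
  pf_set p = [set u | (m <= u)%O] -> join_irreducible m.
Proof.
move=> pE; split=> [m0|a b mE].
  by apply: (@pf_bot _ _ p); rewrite pE m0 /=.
have /pf_prime : pf_set p (a `|` b)%O by rewrite -mE pE /=.
by rewrite pE => -[/= ma|/= mb]; [left|right]; apply/le_anti;
  rewrite ?ma ?mb mE ?leUl ?leUr.
Qed.

End PrimeFilterSpace.

(** * Prime filters of the lattice of homomorphisms *)

Section Dual.
Context (n : nat).
Local Notation cube := (n.-tupleprod bool).
Implicit Types (b : bool) (s t : cube) (u v : homs n) (x y : n.-tuple S3).

Lemma homP f : is_hom (n := n) f <->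
  [/\ forall x y, (forall i, r1 (tnth x i) (tnth y i)) -> r1 (f x) (f y),
      forall x y, (forall i, r2 (tnth x i) (tnth y i)) -> r2 (f x) (f y)
    & forall x y, (forall i, r3 (tnth x i) (tnth y i)) -> r3 (f x) (f y)].
Proof.
split=> [/and3P[/Defs.preservesP ? /Defs.preservesP ? /Defs.preservesP ?] //|].
by move=> [/Defs.preservesP ? /Defs.preservesP ? /Defs.preservesP ?]; apply/and3P.
Qed.

Lemma r1E (a c : S3) : r1 a c = ((a == s1) ==> (sh <= c)%O).
Proof. by case: a => -[|[|[|//]]] ?; case: c => -[|[|[|//]]] ?. Qed.

Lemma r2E (a c : S3) : r2 a c = ((sh <= a)%O ==> (sh <= c)%O).
Proof. by case: a => -[|[|[|//]]] ?; case: c => -[|[|[|//]]] ?. Qed.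

Lemma r3E (a c : S3) : r3 a c = ((a == s1) == (c == s1)).
Proof. by case: a => -[|[|[|//]]] ?; case: c => -[|[|[|//]]] ?. Qed.

(* [b] tells whether a point lies in the distinguished open set.  [s] encodes a
   subset of the coordinates through its complement, because the order of the
   dual space reverses the inclusion of subsets. *)
Definition level b : S3 := if b then sh else s1.

Definition point b s : n.-tuple S3 :=
  [tuple if tnth s i then s0 else level b | i < n].

Lemma tnth_point b s i : tnth (point b s) i = if tnth s i then s0 else level b.
Proof. by rewrite tnth_mktuple. Qed.

Definition supports s x := [forall i, ~~ tnth s i ==> (sh <= tnth x i)%O].

Definition matches s x := [forall i, (tnth x i == s1) == ~~ tnth s i].

Lemma matches_supports s x : matches s x -> supports s x.
Proof.
move=> /forallP sx; apply/forallP => i; apply/implyP => nsi.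
by have /eqP := sx i; rewrite nsi => /eqP ->.
Qed.

(** The least homomorphism with value at least [level b] at [point b s], as [gen_le] shows. *)
Definition gen_fun b s : {ffun n.-tuple S3 -> S3} :=
  [ffun x => if ~~ b && matches s x then s1
             else if supports s x then sh else s0].

Lemma gen_fun_ge_h b s x : (sh <= gen_fun b s x)%O = supports s x.
Proof.
rewrite ffunE; case: ifP => [/andP[_ /matches_supports ->] //|_].
by case: ifP.
Qed.

Lemma gen_fun_eq1 b s x : (gen_fun b s x == s1) = ~~ b && matches s x.
Proof. by rewrite ffunE; case: ifP => // _; case: ifP. Qed.

Lemma gen_hom b s : is_hom (gen_fun b s).
Proof.
apply/homP; split=> x y xy.
- rewrite r1E gen_fun_eq1 gen_fun_ge_h; apply/implyP => /andP[_ /forallP sx].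
  apply/forallP => i; apply/implyP => nsi; move: (xy i) (sx i).
  by rewrite r1E nsi => /implyP + /eqP xi; apply; rewrite xi.
- rewrite r2E !gen_fun_ge_h; apply/implyP => /forallP sx.
  apply/forallP => i; apply/implyP => nsi; move: (xy i) (sx i).
  by rewrite r2E nsi => /implyP.
- rewrite r3E !gen_fun_eq1; apply/eqP; congr (_ && _).
  by apply: eq_forallb => i; have := xy i; rewrite r3E => /eqP ->.
Qed.

Definition gen b s : homs n := exist (@is_hom n) _ (gen_hom b s).

Lemma hom_leP u v : reflect (forall x, (val u x <= val v x)%O) (u <= v)%O.
Proof. exact: forallP. Qed.

Lemma S3_ge1 (a : S3) : (s1 <= a)%O = (a == s1).
Proof. by case: a => -[|[|[|//]]]. Qed.

Lemma supports_point s : supports s (point true s).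
Proof.
by apply/forallP => i; apply/implyP => /negPf nsi; rewrite tnth_point nsi.
Qed.

Lemma matches_point s : matches s (point false s).
Proof. by apply/forallP => i; rewrite tnth_point; case: (tnth s i). Qed.

(* Hence the prime filter generated by [gen b s] is evaluation at [point b s]
   followed by a threshold, which is where primality comes from. *)
Lemma gen_le b s u : (gen b s <= u)%O = (level b <= val u (point b s))%O.
Proof.
have /homP[u1 u2 u3] := valP u.
apply/hom_leP/idP => [/(_ (point b s))|].
  apply: le_trans; rewrite /=; case: b => /=.
    by rewrite gen_fun_ge_h supports_point.
  by rewrite S3_ge1 gen_fun_eq1 matches_point.
move=> us x; rewrite /= ffunE; case: ifP => [/andP[/negPf bF /forallP sx]|_].
  move: us; rewrite bF /= !S3_ge1 => /eqP us.
  (* Matching means that [x] and [point false s] equal 1 at the same coordinates, so [r3] transfers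
     the value 1. *)
  have := u3 (point false s) x; rewrite r3E us eqxx => /(_ _)/eqP <- // i.
  by rewrite r3E tnth_point (eqP (sx i)); case: (tnth s i).
case: ifP => [/forallP sx|_]; last exact: le0x.
case: b us => /= us.
  have := u2 (point true s) x; rewrite r2E us; apply => i.
  by rewrite r2E tnth_point; have := sx i; case: (tnth s i).
have := u1 (point false s) x; rewrite r1E -S3_ge1 us; apply => i.
by rewrite r1E tnth_point; have := sx i; case: (tnth s i).
Qed.

Program Definition point_filter b s : prime_filter (homs n) :=
  @PrimeFilter _ (homs n) [set u | (gen b s <= u)%O] _ _ _ _ _.
Next Obligation. by move=> b s /=; apply: lex1. Qed.
Next Obligation. by move=> b s u v /= uv gu; apply: le_trans uv. Qed.
Next Obligation. by move=> b s u v /= gu gv; rewrite lexI gu. Qed.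
Next Obligation. by move=> b s /=; rewrite gen_le ffunE; case: b. Qed.
Next Obligation.
by move=> b s u v /=; rewrite !gen_le /= ffunE lexU => /orP.
Qed.

(** The common order of both spaces. [true] marks the distinguished copy, and [(false, t)] covers
    only [(true, t)]. *)
Definition cube_le (p q : bool * cube) : bool :=
  if p.1 then (p.2 <= q.2)%O else ~~ q.1 && (p.2 == q.2).

Lemma supports_pointE b s t : supports s (point b t) = (t <= s)%O.
Proof.
rewrite Order.TupleProdOrder.leEtprod; apply: eq_forallb => i.
by rewrite tnth_point; case: (tnth s i); case: (tnth t i); case: b.
Qed.

Lemma matches_pointE s t : matches s (point false t) = (s == t).
Proof.
apply/forallP/eqP => [st|-> i]; last by rewrite tnth_point; case: (tnth t i).
apply: eq_from_tnth => i; have := st i; rewrite tnth_point.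
by case: (tnth s i); case: (tnth t i).
Qed.

Lemma gen_leE b s b' t : (gen b s <= gen b' t)%O = cube_le (b, s) (b', t).
Proof.
rewrite gen_le /cube_le /=; case: b => /=.
  by rewrite gen_fun_ge_h supports_pointE.
by rewrite S3_ge1 gen_fun_eq1 matches_pointE eq_sym.
Qed.

(** The generator [m] of [p] is the join [J] of the elements [gen b s] below it. Primality puts one
    of these in [p], and that one equals [m]. *)
Lemma point_filter_surj (p : prime_filter (homs n)) :
  exists b s, p = point_filter b s.
Proof.
have [m pE] := prime_filter_principal p.
pose J := (\join_(k : bool * cube | (gen k.1 k.2 <= m)%O) gen k.1 k.2)%O.
have genJ b s x : (level b <= val m (point b s))%O ->
    (gen_fun b s x <= val J x)%O.
  rewrite -gen_le => gm.
  by have /hom_leP := @joins_sup _ _ _ (b, s)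
    (fun k => gen k.1 k.2 <= m)%O (fun k => gen k.1 k.2) gm; apply.
have /homP[m1 m2 m3] := valP m.
have pJ : pf_set p J.
  rewrite pE; apply/hom_leP => x.
  have := erefl (val m x); case: {2}(val m x) => -[|[|[|//]]] lt3 mx.
  - by rewrite (_ : val m x = s0) ?le0x //; rewrite mx; apply/val_inj.
  - have mxh : val m x = sh by rewrite mx; apply/val_inj.
    (* With [s] coding the coordinates where [x] is at least h, [r2] relates [x] to
       [point true s]. *)
    pose s : cube := [tuple ~~ (sh <= tnth x i)%O | i < n].
    have sx : supports s x.
      by apply/forallP => i; rewrite tnth_mktuple negbK implybb.
    rewrite mxh; apply: le_trans (genJ true s x _).
      by rewrite gen_fun_ge_h.
    have := m2 x (point true s); rewrite r2E mxh; apply => i.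
    by rewrite r2E tnth_point tnth_mktuple; case: (sh <= tnth x i)%O.
  - have mx1 : val m x = s1 by rewrite mx; apply/val_inj.
    (* With [s] coding the coordinates where [x] is 1, [r3] relates [x] to [point false s]. *)
    pose s : cube := [tuple tnth x i != s1 | i < n].
    have sx : matches s x.
      by apply/forallP => i; rewrite tnth_mktuple negbK.
    rewrite mx1; apply: le_trans (genJ false s x _).
      by rewrite S3_ge1 gen_fun_eq1.
    have := m3 x (point false s); rewrite r3E mx1 S3_ge1 => /(_ _)/eqP <- // i.
    by rewrite r3E tnth_point tnth_mktuple; case: (tnth x i == s1).
have [[b s] /= gm pg] := prime_filter_big_join pJ.
exists b, s; apply: prime_filter_inj; rewrite pE; apply/seteqP.
split=> u /= mu; first exact: le_trans mu.
by move: pg; rewrite pE => /= mg; apply: le_trans mu.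
Qed.

Lemma point_filter_bijective :
  bijective (fun k : bool * cube => point_filter k.1 k.2).
Proof.
rewrite -setTT_bijective; split=> // [[b s] [b' t] _ _ /= E|p _].
  have pE : pf_set (point_filter b s) = pf_set (point_filter b' t) by rewrite E.
  have : pf_set (point_filter b s) (gen b' t) by rewrite pE /=.
  have : pf_set (point_filter b' t) (gen b s) by rewrite -pE /=.
  rewrite /= !gen_leE /cube_le /=.
  case: b b' {E pE} => -[] //= => [ts st|_ /eqP -> //].
  by congr pair; apply: le_anti; rewrite st ts.
by have [b [s ->]] := point_filter_surj p; exists (b, s).
Qed.

Lemma point_filter_open_le (j k : bool * cube) :
  open_le (point_filter j.1 j.2) (point_filter k.1 k.2) <-> cube_le j k.
Proof.
rewrite prime_filter_open_le /=; case: j k => [b s] [b' t] /=; rewrite -gen_leE.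
by split=> [|jk u /= ku]; [apply => /=|apply: le_trans ku].
Qed.

Lemma gen_le_h b s : (gen b s <= hom_const n sh)%O = b.
Proof. by rewrite gen_le /= ffunE; case: b. Qed.

Lemma dual_distinguished_point b s :
  @dual_distinguished _ (hom_pcdl n) (point_filter b s) <-> b.
Proof.
split=> [[x [_ xh /= pE]]|bT].
  rewrite -(gen_le_h b s) /=.
  by have : [set y | (x <= y)%O] (hom_const n sh) by []; rewrite -pE.
exists (gen b s); split => //; last by rewrite /= gen_le_h.
exact: (@prime_filter_join_irreducible _ _ (point_filter b s)).
Qed.

End Dual.

(** * Coding the given space by two copies of the cube *)

Theorem theorem4 (n : nat) (n_ge1 : (1 <= n)%N)
  (X : topologicalType) (Y : set X)
  (XY_pstone : partially_stone Y)
  (Y_cube : iso_bool_power n Y)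
  (antichain : forall x x' : X, (~` Y) x -> (~` Y) x' -> x <> x' ->
     ~ open_le x x' /\ ~ open_le x' x)
  (unique_cover : forall y : X, Y y ->
     exists! x : X, (~` Y) x /\ covers x y)
  (covers_one : forall x : X, (~` Y) x ->
     exists! y : X, Y y /\ covers x y) :
  partially_stone_homeomorphic Y (@dual_distinguished _ (hom_pcdl n)).
Proof.
have [[_ sX] oY _ _] := XY_pstone.
have anti (x y : X) : open_le x y -> open_le y x -> x = y.
  exact: sober_open_le_anti.
have [f [_ finj fsurj] fle] := Y_cube.
(* Outside [Y], [c x] is the point of [Y] covered by [x]; on [Y] its value is a placeholder. *)
have /choice[c cP] (x : X) : exists y, ~ Y x -> Y y /\ covers x y.
  have [Yx|/covers_one[y [yP _]]] := pselect (Y x); first by exists x.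
  by exists y.
have c_uniq x y : ~ Y x -> Y y -> covers x y -> c x = y.
  move=> nYx Yy xy; have [z [_ uz]] := covers_one x nYx.
  by rewrite -(uz (c x)) ?(uz y) //; apply: cP.
pose base x := if `[< Y x >] then x else c x.
pose e x : bool * n.-tupleprod bool := (`[< Y x >], f (base x)).
have baseY x : Y (base x).
  by rewrite /base; case: asboolP => // /cP[].
have base_le x : open_le (base x) x.
  by rewrite /base; case: asboolP => [_|/cP[_ []]] //; apply: open_le_refl.
have e_inj : injective e.
  move=> x y [] /= bE /finj; rewrite !inE => /(_ (baseY x) (baseY y)).
  rewrite /base bE; case: asboolP => // nYy.
  have nYx : ~ Y x by apply/asboolPn; rewrite bE; apply/asboolPn.
  (* Both [x] and [y] cover the same point of [Y], whose cover outside [Y] is unique. *)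
  move=> cE; have [z [_ uz]] := unique_cover (c y) (proj1 (cP _ nYy)).
  rewrite -(uz x) ?(uz y) //; first by split=> //; case: (cP _ nYy).
  by split=> //; rewrite -cE; case: (cP _ nYx).
have e_le x y : open_le x y <-> cube_le (e x) (e y).
  rewrite /cube_le /=; case: (asboolP (Y x)) => [Yx|nYx].
    have -> : base x = x by rewrite /base asboolT.
    rewrite fle //; split; last by move/open_le_trans; apply.
    rewrite /base; case: asboolP => // nYy xy.
    (* By finiteness some [z] above [x] is covered by [y]. The antichain condition puts [z] in [Y],
       so [z] is [c y]. *)
    have [|z xz yz] := finite_covers_exists e_inj anti xy.
      by move=> xE; apply: nYy; rewrite -xE.
    suff Yz : Y z by rewrite (c_uniq _ _ nYy Yz yz).
    apply: contrapT => nYz; have [zy zNy _] := yz.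
    by case: (antichain z y nYz nYy zNy).
  split=> [xy|/andP[/asboolPn nYy /eqP]].
    (* The open set [Y] is closed downwards. *)
    have nYy : ~ Y y by move=> /(xy _ oY).
    rewrite asboolF //=; suff -> : x = y by [].
    by apply: contrapT => xNy; case: (antichain x y nYx nYy xNy).
  move=> /finj; rewrite !inE => /(_ (baseY x) (baseY y)) bE.
  suff -> : x = y by exact: open_le_refl.
  by apply: e_inj; rewrite /e bE !asboolF.
have e_bij : bijective e.
  rewrite -setTT_bijective; split=> // [x y _ _|[b t] _]; first exact: e_inj.
  have [y Yy <-] := fsurj t I.
  case: b; first by exists y; rewrite // /e /base asboolT.
  have [x [[nYx xy] _]] := unique_cover y Yy.
  by exists x; rewrite // /e /base asboolF // (c_uniq _ _ nYx Yy xy).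
have hom := homeomorphism_of_codes e_bij (@point_filter_bijective n) e_le
  (@point_filter_open_le n).
exists ((fun k => point_filter k.1 k.2) \o e); split=> //.
apply/seteqP; split=> [_ [x Yx <-]|p].
  by apply/dual_distinguished_point => /=; apply/asboolP.
have [_ [g [_ gK _]]] := hom.
rewrite -{1}(gK p) => /dual_distinguished_point /asboolP Yg.
by exists (g p).
Qed.
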